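(* Let $n \geq 3$. Let $G \colon \mathbf{Cstar}^{\mathrm{op}} \to \mathbf{Quantale}^{\mathrm{op}}$ be any functor that assigns to each commutative C*-algebra its Gelfand spectrum, i.e. the restriction of $G$ to $\mathbf{cCstar}^{\mathrm{op}}$ is (up to natural isomorphism) the Gelfand spectrum regarded as a functor $\mathbf{cCstar}^{\mathrm{op}} \to \mathbf{Quantale}^{\mathrm{op}}$. Then $G$ trivializes on the C*-algebra $\mathbb{M}_n(\mathbb{C})$ of $n$-by-$n$ complex matrices: $G(\mathbb{M}_n(\mathbb{C}))$ is an initial object of $\mathbf{Quantale}^{\mathrm{op}}$, i.e. a one-element quantale.
   Context: All C*-algebras are unital (the zero algebra, in which $0=1$, is allowed). $\mathbf{Cstar}$ is the category of C*-algebras and unital $*$-homomorphisms, and $\mathbf{cCstar}$ is its full subcategory of commutative C*-algebras. A quantale is a partially ordered set $Q$ that has least upper bounds of arbitrary subsets, and is equipped with an element $e \in Q$ and an associative multiplication $Q \times Q \to Q$ satisfying $\bigvee_i (x y_i) = x (\bigvee_i y_i)$, $\bigvee_i (y_i x) = (\bigvee_i y_i) x$, and $ex = x = xe$. $\mathbf{Quantale}$ is the category whose objects are quantales and whose morphisms $Q \to Q'$ are functions $f \colon Q \to Q'$ satisfying $f(e) = e'$, $f(\bigvee_i x_i) = \bigvee_i f(x_i)$ and $f(xy) = f(x) f(y)$. A locale is a complete lattice $L$ satisfying $\bigvee_i (x \wedge y_i) = x \wedge \bigvee_i y_i$; a morphism of locales $K \to L$ is a function $L \to K$ preserving finite meets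 (including the top element) and arbitrary joins. Any locale is a quantale with meet as multiplication and the top element as unit; so the category of locales is regarded as a subcategory of $\mathbf{Quantale}^{\mathrm{op}}$. The Gelfand spectrum of a commutative C*-algebra $A$ is the locale whose opens are the closed ideals of $A$ ordered by inclusion; equivalently, the locale of open sets of the compact Hausdorff space of characters of $A$. A unital $*$-homomorphism $A \to B$ induces, by precomposition on characters, a morphism of locales from the spectrum of $B$ to that of $A$. In this way the Gelfand spectrum is a functor $\mathbf{cCstar}^{\mathrm{op}} \to \mathbf{Quantale}^{\mathrm{op}}$. *)

(* Defs.v *)
From HB Require Import structures.
From mathcomp Require Import all_boot all_order all_algebra.
From mathcomp Require Import complex.
From mathcomp Require Import all_classical all_reals all_analysis.
Set Implicit Arguments.
Unset Strict Implicit.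
Unset Printing Implicit Defensive.
Import Order.TTheory GRing.Theory Num.Theory.
Import numFieldNormedType.Exports.
Local Open Scope classical_set_scope.
Local Open Scope ring_scope.

Section L2norm.
Variable C : numClosedFieldType.
Local Notation "M ^t*" := (map_mx Num.conj M^T) (at level 30).

Definition l2norm n (x : 'cV[C]_n) : C := sqrtC (\sum_i `|x i 0| ^+ 2).

Lemma l2normE n (x : 'cV[C]_n) : l2norm x = sqrtC (dotmx x^T x^T).
Proof.
rewrite /l2norm dotmxE mxE; congr sqrtC; apply: eq_bigr => i _.
by rewrite !mxE normCK.
Qed.

Lemma l2norm_ge0 n (x : 'cV[C]_n) : 0 <= l2norm x.
Proof. by rewrite sqrtC_ge0 sumr_ge0// => i _; rewrite exprn_ge0. Qed.

Lemma sqr_l2norm n (x : 'cV[C]_n) : l2norm x ^+ 2 = dotmx x^T x^T.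
Proof. by rewrite l2normE sqrtCK. Qed.

Lemma l2norm_eq0 n (x : 'cV[C]_n) : l2norm x = 0 -> x = 0.
Proof.
move/eqP; rewrite l2normE sqrtC_eq0 dnorm_eq0 => /eqP x0.
by rewrite -[x]trmxK x0 trmx0.
Qed.

Lemma l2normZ n (k : C) (x : 'cV[C]_n) : l2norm (k *: x) = `|k| * l2norm x.
Proof.
apply: (pexpIrn (n := 2)) => //; rewrite ?nnegrE ?mulr_ge0 ?l2norm_ge0//.
by rewrite exprMn !sqr_l2norm linearZ/= dnormZ.
Qed.

Lemma l2norm0 n : l2norm (0 : 'cV[C]_n) = 0.
Proof. by rewrite -(scale0r 0) l2normZ normr0 mul0r. Qed.

Lemma l2normD n (x y : 'cV[C]_n) : l2norm (x + y) <= l2norm x + l2norm y.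
Proof. by rewrite !l2normE linearD/=; case: (triangle_lerif (@dotmx C n) x^T y^T). Qed.

Lemma l2norm_sum n (I : finType) (F : I -> 'cV[C]_n) :
  l2norm (\sum_i F i) <= \sum_i l2norm (F i).
Proof.
elim/big_ind2: _ => [|x a y b ha hb|//]; first by rewrite l2norm0.
by rewrite (le_trans (l2normD _ _))// lerD.
Qed.

Lemma l2norm_coord n (x : 'cV[C]_n) i : `|x i 0| <= l2norm x.
Proof.
rewrite -(@ler_pXn2r _ 2) ?nnegrE ?l2norm_ge0// sqrtCK (bigD1 i)//=.
by rewrite lerDl sumr_ge0// => j _; rewrite exprn_ge0.
Qed.

Lemma l2norm_mulmx n (A : 'M[C]_n) (x : 'cV[C]_n) :
  l2norm (A *m x) <= (\sum_j l2norm (col j A)) * l2norm x.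
Proof.
have -> : A *m x = \sum_j x j 0 *: col j A.
  rewrite -[LHS]trmxK trmx_mul mulmx_sum_row linear_sum/=.
  by apply: eq_bigr => j _; rewrite linearZ/= tr_row trmxK mxE.
rewrite (le_trans (l2norm_sum _))// mulr_suml ler_sum// => j _.
by rewrite l2normZ mulrC ler_wpM2l ?l2norm_ge0// l2norm_coord.
Qed.

Lemma adjmxK n (A : 'M[C]_n) : A ^t* ^t* = A.
Proof. by apply/matrixP => i j; rewrite !mxE conjCK. Qed.

Lemma sqr_l2norm_mulmx n (A : 'M[C]_n) (x : 'cV[C]_n) :
  l2norm (A *m x) ^+ 2 <= l2norm x * l2norm (A ^t* *m A *m x).
Proof.
have <- : `|dotmx x^T (A ^t* *m A *m x)^T| = l2norm (A *m x) ^+ 2.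
  rewrite -[RHS]ger0_norm ?exprn_ge0 ?l2norm_ge0// sqr_l2norm; congr `| _ |.
  rewrite !dotmxE !trmxK !map_mxM trmx_mul !mulmxA.
  congr ((_ *m _ *m _ *m _) 0 0).
  by apply/matrixP => i j; rewrite !mxE; exact: conjCK.
rewrite !l2normE.
by case: (CauchySchwarz_sqrt (@dotmx C n) x^T (A ^t* *m A *m x)^T).
Qed.

Lemma l2norm_delta n (i : 'I_n) : l2norm (delta_mx i 0) = 1.
Proof.
rewrite /l2norm (bigD1 i)//= big1 => [|k ki].
  by rewrite mxE !eqxx normr1 expr1n addr0 sqrtC1.
by rewrite mxE (negPf ki) normr0 expr0n.
Qed.

Lemma l2norm_mulmx_coord n (A : 'M[C]_n) (x : 'cV[C]_n) :
  l2norm (A *m x) <= (\sum_i \sum_j `|A i j|) * l2norm x.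
Proof.
rewrite (le_trans (l2norm_mulmx _ _))// ler_wpM2r ?l2norm_ge0//.
rewrite exchange_big/= ler_sum// => j _.
have -> : col j A = \sum_i A i j *: delta_mx i 0 :> 'cV[C]_n.
  apply/colP => i; rewrite summxE (bigD1 i)//= !mxE !eqxx mulr1 big1 ?addr0//.
  by move=> k ki; rewrite !mxE eq_sym (negPf ki) mulr0.
by rewrite (le_trans (l2norm_sum _))// ler_sum// => i _; rewrite l2normZ l2norm_delta mulr1.
Qed.
End L2norm.

(* Naming R[i] as a numClosedFieldType makes the generic topology and norm of
   a numFieldType (numFieldNormedType) apply to it. *)
Definition complexes (R : realType) : numClosedFieldType := R[i].

(* The operator norm on l^2 columns. It is a nonnegative real, embedded in R[i]
   because the norm of a normedModType over K takes its values in K. *)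
HB.lock Definition opnorm (R : realType) n (A : 'M[complexes R]_n) : complexes R :=
  (sup [set complex.Re (l2norm (A *m x)) | x in [set x | l2norm x <= 1]])%:C%C.
Canonical opnorm_unlockable := Unlockable opnorm.unlock.

Section OperatorNorm.
Variable R : realType.
Local Notation C := (complexes R).
Local Notation "M ^t*" := (map_mx Num.conj M^T) (at level 30).

Lemma ge0_ReK (c : C) : 0 <= c -> (complex.Re c)%:C%C = c.
Proof. by move=> c0; apply/RRe_real; exact: ger0_real. Qed.

Lemma le_Re (c d : C) : c <= d -> complex.Re c <= complex.Re d.
Proof. by rewrite lecE => /andP[]. Qed.

Lemma opnorm_has_sup n (A : 'M[C]_n) :
  has_sup [set complex.Re (l2norm (A *m x)) | x in [set x | l2norm x <= 1]].
Proof.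
split; first by exists (complex.Re (l2norm (A *m 0))), 0; rewrite //= l2norm0.
exists (complex.Re (\sum_j l2norm (col j A) : C)) => _ [x /= x1 <-].
apply/le_Re/(le_trans (l2norm_mulmx _ _)).
by rewrite ler_piMr// sumr_ge0// => j _; exact: l2norm_ge0.
Qed.

Lemma opnorm_ge0 n (A : 'M[C]_n) : 0 <= opnorm A.
Proof.
rewrite unlock ler0c; apply: (@le_trans _ _ (complex.Re (l2norm (A *m 0)))).
  by rewrite mulmx0 l2norm0.
apply: sup_upper_bound; first exact: opnorm_has_sup.
by exists 0; rewrite //= l2norm0.
Qed.

Lemma opnorm_ub n (A : 'M[C]_n) x : l2norm (A *m x) <= opnorm A * l2norm x.
Proof.
have [/eqP/l2norm_eq0->|x0] := boolP (l2norm x == 0).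
  by rewrite mulmx0 l2norm0 mulr0.
have xgt0 : 0 < l2norm x by rewrite lt_def x0 l2norm_ge0.
rewrite -ler_pdivrMr// mulrC -[(l2norm x)^-1]ger0_norm ?invr_ge0 ?l2norm_ge0//.
rewrite -l2normZ -linearZ/= -[leLHS]ge0_ReK ?l2norm_ge0// unlock lecR.
apply: sup_upper_bound; first exact: opnorm_has_sup.
exists ((l2norm x)^-1 *: x) => //=; rewrite l2normZ ger0_norm ?invr_ge0 ?l2norm_ge0//.
by rewrite mulVf.
Qed.

Lemma opnorm_le n (A : 'M[C]_n) (c : C) : 0 <= c ->
  (forall x, l2norm (A *m x) <= c * l2norm x) -> opnorm A <= c.
Proof.
move=> c0 h; rewrite -(ge0_ReK c0) unlock lecR; apply: ge_sup.
  by have [] := opnorm_has_sup A.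
by move=> _ [x /= x1 <-]; apply/le_Re/(le_trans (h x)); rewrite ler_piMr.
Qed.

Lemma opnormD n (A B : 'M[C]_n) : opnorm (A + B) <= opnorm A + opnorm B.
Proof.
apply: opnorm_le => [|x]; first by rewrite addr_ge0 ?opnorm_ge0.
by rewrite mulmxDl mulrDl (le_trans (l2normD _ _))// lerD ?opnorm_ub.
Qed.

Lemma opnorm0 n : opnorm (0 : 'M[C]_n) = 0.
Proof.
apply/le_anti; rewrite opnorm_ge0 andbT; apply: opnorm_le => // x.
by rewrite mul0mx l2norm0 mul0r.
Qed.

Lemma opnormZ n (k : C) (A : 'M[C]_n) : opnorm (k *: A) = `|k| * opnorm A.
Proof.
have le l B : opnorm (l *: B) <= `|l| * opnorm B :> C.
  apply: opnorm_le => [|x]; first by rewrite mulr_ge0 ?opnorm_ge0.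
  by rewrite -scalemxAl l2normZ -mulrA ler_wpM2l// opnorm_ub.
apply/le_anti; rewrite le/=.
have [->|k0] := eqVneq k 0; first by rewrite normr0 mul0r opnorm_ge0.
rewrite -[A in leLHS](scalerK k0) -ler_pdivlMl ?normr_gt0//.
by rewrite -normfV le.
Qed.

Lemma opnorm_eq0 n (A : 'M[C]_n) : opnorm A = 0 -> A = 0.
Proof.
move=> A0; apply/matrixP => i j; rewrite !mxE.
have /l2norm_eq0/colP/(_ i) : l2norm (A *m delta_mx j 0) = 0 :> C.
  apply/le_anti; rewrite l2norm_ge0 andbT.
  by have := opnorm_ub A (delta_mx j 0); rewrite A0 mul0r.
by rewrite -colE !mxE.
Qed.

Lemma opnormM n (A B : 'M[C]_n) : opnorm (A *m B) <= opnorm A * opnorm B.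
Proof.
apply: opnorm_le => [|x]; first by rewrite mulr_ge0 ?opnorm_ge0.
rewrite -mulmxA (le_trans (opnorm_ub _ _))// -mulrA.
by rewrite ler_wpM2l ?opnorm_ge0// opnorm_ub.
Qed.

Lemma sqr_opnorm_le n (A : 'M[C]_n) : opnorm A ^+ 2 <= opnorm (A ^t* *m A).
Proof.
have c0 := opnorm_ge0 (A ^t* *m A).
rewrite -[leRHS]sqrtCK ler_pXn2r ?nnegrE ?sqrtC_ge0 ?opnorm_ge0//.
apply: opnorm_le => [|x]; first by rewrite sqrtC_ge0.
rewrite -(@ler_pXn2r _ 2) ?nnegrE ?mulr_ge0 ?l2norm_ge0 ?sqrtC_ge0//.
rewrite exprMn [X in _ <= X * _]sqrtCK (le_trans (sqr_l2norm_mulmx _ _))//.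
rewrite expr2 mulrA mulrC ler_wpM2r ?l2norm_ge0//.
exact: opnorm_ub.
Qed.

Lemma opnorm_adj_le n (A : 'M[C]_n) : opnorm A <= opnorm (A ^t*).
Proof.
have [->|A0] := eqVneq (opnorm A) 0; first exact: opnorm_ge0.
have Agt0 : 0 < opnorm A by rewrite lt_def A0 opnorm_ge0.
rewrite -(ler_pM2r Agt0) -expr2.
exact: le_trans (sqr_opnorm_le A) (opnormM _ _).
Qed.

Lemma opnorm_adj n (A : 'M[C]_n) : opnorm (A ^t*) = opnorm A.
Proof.
have := opnorm_adj_le (A ^t*); rewrite adjmxK => h.
by apply/le_anti; rewrite h opnorm_adj_le.
Qed.

Lemma opnorm_adjM n (A : 'M[C]_n) : opnorm (A ^t* *m A) = opnorm A ^+ 2.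
Proof.
apply/le_anti; rewrite sqr_opnorm_le andbT expr2.
by rewrite -[X in _ <= X * _](opnorm_adj A) opnormM.
Qed.

Lemma opnorm_coord n (A : 'M[C]_n) i j : `|A i j| <= opnorm A.
Proof.
have -> : A i j = (A *m delta_mx j 0 : 'cV_n) i 0 by rewrite -colE mxE.
rewrite (le_trans (l2norm_coord _ _))// (le_trans (opnorm_ub _ _))//.
by rewrite l2norm_delta mulr1.
Qed.

Lemma opnorm_le_sum n (A : 'M[C]_n) : opnorm A <= \sum_i \sum_j `|A i j|.
Proof.
apply: opnorm_le => [|x]; first by do 2!rewrite sumr_ge0// => ? _.
exact: l2norm_mulmx_coord.
Qed.
End OperatorNorm.

Section Completeness.
Variable R : realType.
Local Notation C := (complexes R).

Lemma norm_le_ReIm (z : C) :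
  `|z| <= (`|complex.Re z| + `|complex.Im z|)%:C%C.
Proof.
rewrite normc_def lecR -[leRHS]ger0_norm ?addr_ge0// -[leRHS]sqrtr_sqr ler_wsqrtr//.
rewrite sqrrD !real_normK ?num_real// lerD2r lerDl.
by rewrite mulrn_wge0 ?mulr_ge0.
Qed.

Lemma norm_Re_le (z : C) : `|complex.Re z|%:C%C <= `|z|.
Proof.
rewrite normc_def lecR -[leLHS]sqrtr_sqr ler_wsqrtr//.
by rewrite lerDl sqr_ge0.
Qed.

Lemma norm_Im_le (z : C) : `|complex.Im z|%:C%C <= `|z|.
Proof.
rewrite normc_def lecR -[leLHS]sqrtr_sqr ler_wsqrtr//.
by rewrite lerDr sqr_ge0.
Qed.

Lemma complexes_complete (F : set_system C^o) :
  ProperFilter F -> cauchy F -> cvg F.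
Proof.
move=> FF /cauchy_ballP Fc.
have lip (f : C -> R) : (forall x y : C, `|f x - f y|%:C%C <= `|x - y|) ->
    exists l : R, f @ F --> l.
  move=> flip; apply/cvg_ex; apply: cauchy_cvg; apply/cauchy_ballP => e e0.
  rewrite near_map2.
  have := Fc e%:C%C; rewrite ltcR => /(_ e0).
  by apply: filterS => -[x y] /= xy; rewrite /ball/= -ltcR (le_lt_trans (flip _ _)).
have [|a Fa] := lip (@complex.Re R).
  by move=> x y; rewrite -raddfB norm_Re_le.
have [|b Fb] := lip (@complex.Im R).
  by move=> x y; rewrite -raddfB norm_Im_le.
apply/cvg_ex; exists (a +i* b)%C; apply/cvgrPdist_lt => e e0.
have e2 : 0 < complex.Re e / 2.
  by rewrite divr_gt0//; move: e0; rewrite ltcE => /andP[].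
have eE : e = (complex.Re e / 2 + complex.Re e / 2)%:C%C.
  by rewrite -splitr RRe_real// gtr0_real.
near=> z.
rewrite (le_lt_trans (norm_le_ReIm _))// eE ltcR ltrD//.
- rewrite raddfB/=; near: z.
  by move/cvgrPdist_lt : Fa; exact.
- rewrite raddfB/=; near: z.
  by move/cvgrPdist_lt : Fb; exact.
Unshelve. all: by end_near. Qed.

End Completeness.

(* C as an algebra over itself. The regular type K^o already carries the
   completeness instance of realType, hence a separate name. *)
Definition complex_alg (R : realType) : Type := (complexes R)^o.

HB.instance Definition _ (R : realType) :=
  NormedModule.copy (complex_alg R) (complexes R)^o.
HB.instance Definition _ (R : realType) := isPointed.Build (complex_alg R) 0.
HB.instance Definition _ (R : realType) :=
  Uniform_isComplete.Build (complex_alg R) (@complexes_complete R).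

(* The product is written in group_scope: it is a Monoid structure and not a
   ring, because Hierarchy-Builder cannot join PzSemiRing with normed modules
   downstream of numDomainType. Together with mulgDl ... scalegAr it makes A a
   unital algebra; 1 != 0 is not required, so the zero algebra is included. *)
HB.mixin Record isCstar (R : realType) A
    of CompleteNormedModule (complexes R) A & Monoid A := {
  mulgDl : forall a b c : A, ((a + b)%R * c)%g = (a * c)%g + (b * c)%g;
  mulgDr : forall a b c : A, (a * (b + c)%R)%g = (a * b)%g + (a * c)%g;
  scalegAl : forall (k : complexes R) (a b : A),
    ((k *: a)%R * b)%g = k *: (a * b)%g;
  scalegAr : forall (k : complexes R) (a b : A),
    (a * (k *: b)%R)%g = k *: (a * b)%g;
  normgM_le : forall a b : A, `|(a * b)%g| <= `|a| * `|b|;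
  star : A -> A;
  starK : involutive star;
  starD : {morph star : a b / a + b};
  starZ : forall (k : complexes R) a, star (k *: a) = k^* *: star a;
  starM : forall a b, star (a * b)%g = (star b * star a)%g;
  norm_starM : forall a : A, `|(star a * a)%g| = `|a| ^+ 2
}.

#[short(type="cstarType")]
HB.structure Definition Cstar (R : realType) :=
  {A of isCstar R A & CompleteNormedModule (complexes R) A & Monoid A}.

Section ComplexAlg.
Variable R : realType.
Local Notation A := (complex_alg R).
Local Notation C := (complexes R).

HB.instance Definition _ :=
  isMonoid.Build A (@mulrA C) (@mul1r C) (@mulr1 C).

Let scaleAl (k a b : C) : k * a * b = k * (a * b).
Proof. by rewrite mulrA. Qed.

Let normM_le (a b : C) : `|a * b| <= `|a| * `|b|.
Proof. by rewrite normrM. Qed.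

Let conjD : {morph (@Num.conj C) : a b / a + b}.
Proof. exact: rmorphD. Qed.

Let conjM (a b : C) : (a * b)^* = a^* * b^*.
Proof. exact: rmorphM. Qed.

Let conjM_rev (a b : C) : (a * b)^* = b^* * a^*.
Proof. by rewrite conjM mulrC. Qed.

Let norm_conjM (a : C) : `|a^* * a| = `|a| ^+ 2.
Proof. by rewrite normrM norm_conjC. Qed.

HB.instance Definition _ := isCstar.Build R A
  (@mulrDl C) (@mulrDr C) scaleAl (fun k a b => @mulrCA C a k b) normM_le
  (@conjCK C) conjD conjM conjM_rev norm_conjM.
End ComplexAlg.

(* A name distinct from 'M_n, which is canonically normed by the maximum of
   the entries; here the norm is the operator norm. *)
Definition cmatrix (R : realType) (n : nat) : Type := 'M[complexes R]_n.

Section MatrixAlg.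
Variables (R : realType) (n : nat).
Local Notation C := (complexes R).
Local Notation M := (cmatrix R n).
Local Notation "A ^t*" := (map_mx Num.conj A^T) (at level 30).

HB.instance Definition _ := GRing.Lmodule.copy M 'M[C]_n.
HB.instance Definition _ := Lmodule_isNormed.Build C M
  (@opnormD R n) (@opnormZ R n) (@opnorm_eq0 R n).

Lemma cmatrix_complete (F : set_system M) :
  ProperFilter F -> cauchy F -> cvg F.
Proof.
move=> FF /cauchy_ballP Fc.
have Fij i j : exists l : complex_alg R, (fun A : M => A i j : complex_alg R) @ F --> l.
  apply/cvg_ex; apply: cauchy_cvg; apply/cauchy_ballP => e e0.
  rewrite near_map2; have := Fc _ e0.
  apply: filterS => -[A B]; rewrite -!ball_normE/= => AB.
  apply: le_lt_trans AB; have := opnorm_coord (A - B : 'M[C]_n) i j.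
  by rewrite !mxE.
pose L : M := \matrix_(i, j) sval (cid (Fij i j)).
apply/cvg_ex; exists L; apply/cvgrPdist_lt => e e0.
have e1 : 0 < e / (n * n).+1%:R by rewrite divr_gt0.
have H : F [set A : M | forall i j, `|L i j - A i j| < e / (n * n).+1%:R].
  apply: filter_forall => i; apply: filter_forall => j.
  rewrite /L mxE; case: cid => l /= /cvgrPdist_lt; exact.
apply: filterS H => A LA; apply: (le_lt_trans (opnorm_le_sum (L - A))).
apply: (@le_lt_trans _ _ (\sum_(i < n) \sum_(j < n) (e / (n * n).+1%:R))).
  by apply: ler_sum => i _; apply: ler_sum => j _; move: (LA i j) => /ltW; rewrite !mxE.
rewrite !sumr_const !card_ord -mulrnA -[X in X < _]mulr_natr mulrAC.
by rewrite ltr_pdivrMr// ltr_pM2l// ltr_nat.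
Qed.

HB.instance Definition _ := Uniform_isComplete.Build M cmatrix_complete.
HB.instance Definition _ :=
  isMonoid.Build M (@mulmxA C n n n n) (@mul1mx C n n) (@mulmx1 C n n).

Let adjD : {morph (fun A : 'M[C]_n => A ^t*) : A B / A + B}.
Proof. by move=> A B; apply/matrixP => i j; rewrite !mxE rmorphD. Qed.

Let adjZ k (A : 'M[C]_n) : (k *: A) ^t* = k^* *: A ^t*.
Proof. by apply/matrixP => i j; rewrite !mxE rmorphM. Qed.

Let adjM (A B : 'M[C]_n) : (A *m B) ^t* = B ^t* *m A ^t*.
Proof. by rewrite trmx_mul map_mxM. Qed.

Let scaleAl (k : C) (A B : 'M[C]_n) : (k *: A) *m B = k *: (A *m B).
Proof. by rewrite scalemxAl. Qed.

Let scaleAr (k : C) (A B : 'M[C]_n) : A *m (k *: B) = k *: (A *m B).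
Proof. by rewrite scalemxAr. Qed.

HB.instance Definition _ := isCstar.Build R M
  (@mulmxDl C n n n) (@mulmxDr C n n n) scaleAl scaleAr (@opnormM R n)
  (@adjmxK C n) adjD adjZ adjM (@opnorm_adjM R n).
End MatrixAlg.

(* comp is in diagrammatic order: comp f g is f followed by g. *)
Record category := Category {
  obj :> Type;
  hom : obj -> obj -> Type;
  idm : forall X, hom X X;
  comp : forall X Y Z, hom X Y -> hom Y Z -> hom X Z;
  comp_id_l : forall X Y (f : hom X Y), comp (idm X) f = f;
  comp_id_r : forall X Y (f : hom X Y), comp f (idm Y) = f;
  compA : forall X Y Z W (f : hom X Y) (g : hom Y Z) (h : hom Z W),
    comp f (comp g h) = comp (comp f g) h
}.
Arguments hom {c}.
Arguments idm {c}.
Arguments comp {c X Y Z}.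

Definition opposite (D : category) : category := @Category D
  (fun X Y => hom Y X) idm (fun X Y Z f g => comp g f)
  (fun X Y f => comp_id_r f) (fun X Y f => comp_id_l f)
  (fun X Y Z W f g h => esym (compA h g f)).

Definition full_subcategory (D : category) (P : D -> Prop) : category :=
  @Category {X : D | P X} (fun X Y => hom (sval X) (sval Y))
  (fun X => idm (sval X)) (fun X Y Z f g => comp f g)
  (fun X Y f => comp_id_l f) (fun X Y f => comp_id_r f)
  (fun X Y Z W f g h => compA f g h).

Record functor (D E : category) := Functor {
  fobj :> D -> E;
  fmap : forall X Y, hom X Y -> hom (fobj X) (fobj Y);
  fmap_id : forall X, fmap (idm X) = idm (fobj X);
  fmap_comp : forall X Y Z (f : hom X Y) (g : hom Y Z),
    fmap (comp f g) = comp (fmap f) (fmap g)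
}.
Arguments fmap {D E} _ {X Y}.

Definition restrict_op (D E : category) (P : D -> Prop)
    (G : functor (opposite D) E) :
  functor (opposite (full_subcategory P)) E :=
  @Functor (opposite (full_subcategory P)) E (fun X => G (sval X))
    (fun X Y f => @fmap _ _ G (sval X) (sval Y) f)
    (fun X => fmap_id G (sval X))
    (fun X Y Z f g => @fmap_comp _ _ G (sval X) (sval Y) (sval Z) f g).

Definition is_iso (D : category) (X Y : D) (f : hom X Y) :=
  exists g : hom Y X, comp f g = idm X /\ comp g f = idm Y.

Definition naturally_isomorphic (D E : category) (F G : functor D E) :=
  exists eta : forall X, hom (F X) (G X),
    (forall X, is_iso (eta X)) /\
    (forall X Y (f : hom X Y),
       comp (fmap F f) (eta Y) = comp (eta X) (fmap G f)).

Definition is_initial (D : category) (X : D) :=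
  forall Y : D, exists f : hom X Y, forall g : hom X Y, g = f.

Record star_hom (R : realType) (A B : cstarType R) := StarHom {
  star_hom_fun :> A -> B;
  star_hom_linear : linear star_hom_fun;
  star_hom1 : star_hom_fun 1%g = 1%g;
  star_homM : forall a b, star_hom_fun (a * b)%g = (star_hom_fun a * star_hom_fun b)%g;
  star_homJ : forall a, star_hom_fun (star a) = star (star_hom_fun a)
}.

Section Cstar_category.
Variable R : realType.

Lemma star_hom_ext (A B : cstarType R) (f g : star_hom A B) : f =1 g -> f = g.
Proof.
case: f => f fL f1 fM fJ; case: g => g gL g1 gM gJ /= /funext fg; subst g.
by congr StarHom; exact: Prop_irrelevance.
Qed.

Definition star_hom_id (A : cstarType R) : star_hom A A :=
  @StarHom R A A idfun (fun _ _ _ => erefl) erefl (fun _ _ => erefl) (fun=> erefl).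

Definition star_hom_comp (A B D : cstarType R) (f : star_hom A B)
  (g : star_hom B D) : star_hom A D.
Proof.
exists (g \o f) => [k a b||a b|a] /=.
- by rewrite !star_hom_linear.
- by rewrite !star_hom1.
- by rewrite !star_homM.
- by rewrite !star_homJ.
Defined.

Lemma star_hom_comp1l (A B : cstarType R) (f : star_hom A B) :
  star_hom_comp (star_hom_id A) f = f.
Proof. exact: star_hom_ext. Qed.

Lemma star_hom_comp1r (A B : cstarType R) (f : star_hom A B) :
  star_hom_comp f (star_hom_id B) = f.
Proof. exact: star_hom_ext. Qed.

Lemma star_hom_compA (A B D E : cstarType R) (f : star_hom A B)
    (g : star_hom B D) (h : star_hom D E) :
  star_hom_comp f (star_hom_comp g h) = star_hom_comp (star_hom_comp f g) h.
Proof. exact: star_hom_ext. Qed.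

Definition Cstar_cat : category :=
  Category star_hom_comp1l star_hom_comp1r star_hom_compA.

Definition commutative_alg (A : Cstar_cat) :=
  forall a b : A : cstarType R, (a * b = b * a)%g.

Definition cCstar_cat := full_subcategory commutative_alg.
End Cstar_category.

(* Displays only control printing, so a single one serves all quantales. *)
Fact quantale_display : Order.disp_t. Proof. exact: Order.Disp tt tt. Qed.

HB.mixin Record isQuantale Q of Order.POrder quantale_display Q & Monoid Q := {
  has_lub : forall S : set Q, exists s, isLub S s;
  mulg_lubr : forall (x : Q) (S : set Q) s,
    isLub S s -> isLub [set (x * y)%g | y in S] (x * s)%g;
  mulg_lubl : forall (x : Q) (S : set Q) s,
    isLub S s -> isLub [set (y * x)%g | y in S] (s * x)%g
}.

#[short(type="quantaleType")]
HB.structure Definition Quantale :=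
  {Q of isQuantale Q & Order.POrder quantale_display Q & Monoid Q}.

Record quantale_hom (P Q : quantaleType) := QuantaleHom {
  quantale_hom_fun :> P -> Q;
  quantale_hom1 : quantale_hom_fun 1%g = 1%g;
  quantale_homM : forall x y,
    quantale_hom_fun (x * y)%g = (quantale_hom_fun x * quantale_hom_fun y)%g;
  quantale_hom_lub : forall (S : set P) s,
    isLub S s -> isLub (quantale_hom_fun @` S) (quantale_hom_fun s)
}.

Lemma quantale_hom_ext (P Q : quantaleType) (f g : quantale_hom P Q) :
  f =1 g -> f = g.
Proof.
case: f => f f1 fM fL; case: g => g g1 gM gL /= /funext fg; subst g.
congr QuantaleHom; exact: Prop_irrelevance.
Qed.

Definition quantale_hom_id (Q : quantaleType) : quantale_hom Q Q.
Proof. by exists id => // S s; rewrite image_id. Defined.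

Definition quantale_hom_comp (P Q U : quantaleType) (f : quantale_hom P Q)
  (g : quantale_hom Q U) : quantale_hom P U.
Proof.
exists (g \o f) => [|x y|S s Ss] /=.
- by rewrite !quantale_hom1.
- by rewrite !quantale_homM.
- by rewrite -(image_comp f g); do 2 apply: quantale_hom_lub.
Defined.

Lemma quantale_hom_comp1l (P Q : quantaleType) (f : quantale_hom P Q) :
  quantale_hom_comp (quantale_hom_id P) f = f.
Proof. exact: quantale_hom_ext. Qed.

Lemma quantale_hom_comp1r (P Q : quantaleType) (f : quantale_hom P Q) :
  quantale_hom_comp f (quantale_hom_id Q) = f.
Proof. exact: quantale_hom_ext. Qed.

Lemma quantale_hom_compA (P Q U V : quantaleType) (f : quantale_hom P Q)
    (g : quantale_hom Q U) (h : quantale_hom U V) :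
  quantale_hom_comp f (quantale_hom_comp g h) =
  quantale_hom_comp (quantale_hom_comp f g) h.
Proof. exact: quantale_hom_ext. Qed.

Definition Quantale_cat : category :=
  Category quantale_hom_comp1l quantale_hom_comp1r quantale_hom_compA.

(* The locale of open sets of T, as a quantale: the product is the
   intersection, the unit is the whole space. *)
Record opens (T : topologicalType) := Opens {
  open_set :> set T;
  open_setP : open_set \in open
}.

Section Opens.
Variable T : topologicalType.

HB.instance Definition _ := [isSub for @open_set T].
HB.instance Definition _ := [Choice of opens T by <:].
HB.instance Definition _ :=
  [SubChoice_isSubPOrder of opens T by <: with quantale_display].

Implicit Types U V W : opens T.

Lemma opens_leE U V : (U <= V)%O = (U `<=` V) :> Prop.
Proof. by rewrite -subsetEset. Qed.

Lemma opens_open U : open U. Proof. exact/set_mem/open_setP. Qed.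

Definition mk_opens (A : set T) (oA : open A) : opens T := Opens (mem_set oA).

Definition opens_meet U V := mk_opens (openI (opens_open U) (opens_open V)).

Let opens_union_open (S : set (opens T)) : open (\bigcup_(U in S) U).
Proof. by apply: bigcup_open => U _; exact: opens_open. Qed.

Definition opens_union S := mk_opens (opens_union_open S).

Lemma opens_unionP S : isLub S (opens_union S).
Proof.
split=> [U SU|V UV]; rewrite opens_leE /=; first exact: bigcup_sup.
by apply: bigcup_sub => U /UV; rewrite opens_leE.
Qed.

Lemma opens_lubE S W : isLub S W -> W = opens_union S.
Proof.
move=> [WS W_le]; have [US U_le] := opens_unionP S.
by apply/le_anti; rewrite W_le// U_le.
Qed.

Let meetA : associative opens_meet.
Proof. by move=> U V W; apply/val_inj; rewrite /= setIA. Qed.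

Let meet1 : left_id (mk_opens openT) opens_meet.
Proof. by move=> U; apply/val_inj; rewrite /= setTI. Qed.

Let meetx1 : right_id (mk_opens openT) opens_meet.
Proof. by move=> U; apply/val_inj; rewrite /= setIT. Qed.

HB.instance Definition _ := isMonoid.Build (opens T) meetA meet1 meetx1.

Let meet_lubr U (S : set (opens T)) W :
  isLub S W -> isLub [set (U * V)%g | V in S] (U * W)%g.
Proof.
move/opens_lubE => ->.
have -> : (U * opens_union S)%g = opens_union [set (U * V)%g | V in S].
  by apply/val_inj; rewrite /= bigcup_image setI_bigcupr.
exact: opens_unionP.
Qed.

Let meet_lubl U (S : set (opens T)) W :
  isLub S W -> isLub [set (V * U)%g | V in S] (W * U)%g.
Proof.
have mC V W' : (V * W' = W' * V)%g by apply/val_inj; rewrite /= setIC.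
by move/(meet_lubr U); rewrite mC; under eq_imagel do rewrite mC.
Qed.

Let opens_has_lub (S : set (opens T)) : exists W, isLub S W.
Proof. by exists (opens_union S); exact: opens_unionP. Qed.

HB.instance Definition _ :=
  isQuantale.Build (opens T) opens_has_lub meet_lubr meet_lubl.
End Opens.

Section OpensPreimage.
Variables (S T : topologicalType) (f : S -> T) (cf : continuous f).

Definition opens_preimage_fun (U : opens T) : opens S :=
  mk_opens ((continuousP f).1 cf _ (opens_open U)).

Definition opens_preimage : quantale_hom (opens T) (opens S).
Proof.
exists opens_preimage_fun => [|U V|X W XW].
- exact/val_inj.
- exact/val_inj.
- rewrite (opens_lubE XW).
  have -> : opens_preimage_fun (opens_union X) =
            opens_union (opens_preimage_fun @` X).
    by apply/val_inj; rewrite /= bigcup_image preimage_bigcup.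
  exact: opens_unionP.
Defined.
End OpensPreimage.

Section Gelfand.
Variable R : realType.
Local Notation C := (complexes R).

Definition character (A : cstarType R) := star_hom A (complex_alg R).

HB.instance Definition _ A := gen_eqMixin (character A).
HB.instance Definition _ A := gen_choiceMixin (character A).

(* The codomain fixes the topology of pointwise convergence. *)
Definition character_fun (A : cstarType R) (chi : character A) : {ptws A -> C} := chi.

Definition spectrum (A : cstarType R) : topologicalType :=
  initial_topology (@character_fun A).

Definition spectrum_map (A B : cstarType R) (f : star_hom A B) :
  spectrum B -> spectrum A := fun chi => star_hom_comp f chi.

Lemma character_eval_continuous (A : cstarType R) (a : A) :
  continuous (fun chi : spectrum A => character_fun chi a).
Proof.
move=> chi.
exact: (cvg_comp _ _ (@initial_continuous _ _ (@character_fun A) chi)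
  (@proj_continuous A (fun=> C) a (character_fun chi))).
Qed.

Lemma spectrum_map_continuous (A B : cstarType R) (f : star_hom A B) :
  continuous (spectrum_map f).
Proof.
apply: continuous_comp_initial => chi.
have FF : Filter (nbhs ((@character_fun A \o spectrum_map f) x @[x --> chi])).
  by apply: fmap_filter; exact: nbhs_filter.
apply/pointwise_cvgP => a.
exact: (@character_eval_continuous B (f a) chi).
Qed.

Definition spectrum_pullback (A B : cstarType R) (f : star_hom A B) :
    quantale_hom (opens (spectrum A)) (opens (spectrum B)) :=
  opens_preimage (@spectrum_map_continuous A B f).

Lemma spectrum_pullback_id (A : cstarType R) :
  spectrum_pullback (star_hom_id A) = quantale_hom_id (opens (spectrum A)).
Proof.
apply: quantale_hom_ext => U; apply/val_inj/seteqP.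
by split=> chi; rewrite /= /spectrum_map star_hom_comp1l.
Qed.

Lemma spectrum_pullback_comp (A B D : cstarType R) (f : star_hom A B)
    (g : star_hom B D) :
  spectrum_pullback (star_hom_comp f g) =
  quantale_hom_comp (spectrum_pullback f) (spectrum_pullback g).
Proof.
apply: quantale_hom_ext => U; apply/val_inj/seteqP.
by split=> chi; rewrite /= /spectrum_map star_hom_compA.
Qed.

(* A morphism from A to B in the opposite category is a *-homomorphism
   f : B -> A, and chi |-> chi \o f is the induced map of spectra
   spectrum A -> spectrum B; opens pull back along it. *)
Definition Gelfand : functor (opposite (cCstar_cat R)) (opposite Quantale_cat) :=
  @Functor (opposite (cCstar_cat R)) (opposite Quantale_cat)
    (fun A => opens (spectrum (sval A)))
    (fun A B f => @spectrum_pullback (sval B) (sval A) f)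
    (fun A => spectrum_pullback_id (sval A))
    (fun A B D f g => @spectrum_pullback_comp (sval D) (sval B) (sval A) g f).
End Gelfand.

(* Main.v *)
Require Import Defs.
From HB Require Import structures.
From mathcomp Require Import all_boot all_order all_algebra.
From mathcomp Require Import all_classical all_reals all_analysis.
Set Implicit Arguments.
Unset Strict Implicit.
Unset Printing Implicit Defensive.
Import Order.TTheory GRing.Theory Num.Theory.
Import numFieldNormedType.Exports.
Local Open Scope classical_set_scope.
Local Open Scope ring_scope.

Local Notation "M ^t*" := (map_mx Num.conj M^T) (at level 30).

(** Composed with the inclusion of a commutative subalgebra, the natural
    isomorphism sends opens of Gelfand spectra into the quantale
    Q = G(M_n(C)). A resolution of the identity of M_n(C) into k orthogonal
    projections p_i is a unital *-homomorphism from C^k, and the i-th point of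
    the spectrum of C^k goes to an element v(p_i) of Q. Naturality makes v(p_i)
    depend on the projection p_i alone, not on the resolution around it
    ([projection_coloring]). Since points of C^k are disjoint and cover the
    spectrum, v(p_i) v(p_j) is the bottom 0 for i <> j, and the join of the
    v(p_i) is the unit e: v behaves like a two-valued coloring of the
    projections in the sense of Kochen and Specker, with truth values in Q.

    The Kochen-Specker contradiction survives in Q, even though Q need not be
    commutative ([kochen_specker]). Fix t in Q, read t v(p) = 0 as: t refutes
    p. If t refutes all members of a resolution but p, then t <= t v(p), so t
    also refutes every projection orthogonal to p; and if t refutes a whole
    resolution, then t = 0. In this calculus, some rays with small integer
    coordinates in dimension three show that v(p) = 0 when p is the projection
    on a coordinate axis.

    In dimension n > 3, each axis lies in the image of an isometry from C^3, and
    the projection on the orthogonal complement of that image is added to every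
    resolution as a last member; it is orthogonal to the axis, hence harmless
    ([isometric_ray_bot]). So v vanishes on all coordinate axes. They resolve
    the identity, hence e = 0, and a quantale in which e = 0 has one element. *)

(** * Quantales *)

Section QuantaleFacts.
Variable Q : quantaleType.
Implicit Types (x y z : Q) (S : set Q).

Lemma isLub_unique S x y : isLub S x -> isLub S y -> x = y.
Proof. by move=> [Sx lx] [Sy ly]; apply/le_anti; rewrite lx// ly. Qed.

Lemma bot_le z x : isLub set0 z -> (z <= x)%O.
Proof. by move=> [_]; apply => y. Qed.

Lemma le_bot z x : isLub set0 z -> (x <= z)%O -> x = z.
Proof. by move=> z0 xz; apply/le_anti; rewrite xz (bot_le _ z0). Qed.

Lemma mulg_bot z x : isLub set0 z -> (x * z)%g = z.
Proof.
move=> z0; have := mulg_lubr x _ _ z0; rewrite image_set0 => xz0.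
exact: isLub_unique xz0 z0.
Qed.

Lemma quantale_le_mul2l x y t : (x <= y)%O -> ((t * x)%g <= (t * y)%g)%O.
Proof.
move=> xy; have xyL : isLub [set x; y] y.
  by split=> [u [->|->]//|u]; apply; right.
by have [+ _] := mulg_lubr t _ _ xyL; apply; exists x => //; left.
Qed.

Lemma quantale_le_mul2r x y t : (x <= y)%O -> ((x * t)%g <= (y * t)%g)%O.
Proof.
move=> xy; have xyL : isLub [set x; y] y.
  by split=> [u [->|->]//|u]; apply; right.
by have [+ _] := mulg_lubl t _ _ xyL; apply; exists x => //; left.
Qed.

(** Reasoning by cases: a family with join the unit splits any [t] into the
    parts [t * f i]. *)
Lemma unit_lub_le (I : Type) (f : I -> Q) t x : isLub (range f) 1%g ->
  (forall i, (t * f i)%g <= x)%O -> (t <= x)%O.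
Proof.
move=> /(mulg_lubr t)[_ lub] tf; rewrite -[t]mulg1; apply: lub.
by move=> _ [_ [i _ <-] <-].
Qed.

Lemma quantale_trivial z : isLub set0 z -> z = 1%g -> forall x, x = z.
Proof. by move=> z0 z1 x; rewrite -[x]mulg1 -z1 mulg_bot. Qed.
End QuantaleFacts.

(** * A Kochen-Specker contradiction in three dimensions *)

(** Triples rather than columns: orthogonality of explicit rays is then decided
    by computation. *)
Definition ivec := (int * int * int)%type.

Definition idot (a b : ivec) : int :=
  a.1.1 * b.1.1 + a.1.2 * b.1.2 + a.2 * b.2.

(** In the intended instance, [v a] is the value of the projection on the line
    spanned by the image of [a] under an isometry from C^3 to C^n, and [r] is
    the value of the projection on the complement of the image. *)
Section KochenSpecker.
Variables (Q : quantaleType) (z : Q) (v : ivec -> Q) (r : Q).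
Hypothesis z0 : isLub set0 z.
Hypothesis v_le1 : forall a, (v a <= 1%g)%O.
Hypothesis v_orth : forall a b, idot a b = 0 -> (v a * v b)%g = z.
Hypothesis v_basis : forall a b c, idot a a != 0 -> idot b b != 0 ->
  idot c c != 0 -> idot a b = 0 -> idot a c = 0 -> idot b c = 0 ->
  forall t x : Q, ((t * v a)%g <= x -> (t * v b)%g <= x -> (t * v c)%g <= x ->
    (t * r)%g <= x -> t <= x)%O.

(** Truth relative to [t]: [excludes t a] says that [a] is false, [forces t a]
    has the consequences of [a] being true. *)
Let excludes (t : Q) a := (t * v a)%g = z.
Let forces t a := forall b, idot a b = 0 -> excludes t b.

Let forces_mul t a : forces (t * v a)%g a.
Proof. by move=> b ab; rewrite /excludes -mulgA v_orth// mulg_bot. Qed.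

(** All members of the resolution except [c] being excluded, [t <= t * v c],
    and [t * v c] forces [c]. *)
Let forcing t a b c : (t * r)%g = z ->
  idot a a != 0 -> idot b b != 0 -> idot c c != 0 ->
  idot a b = 0 -> idot a c = 0 -> idot b c = 0 ->
  excludes t a -> excludes t b -> forces t c.
Proof.
move=> tr a0 b0 c0 ab ac bc ta tb d cd; apply: (le_bot z0).
have ttc : (t <= (t * v c)%g)%O.
  by apply: (v_basis a0 b0 c0 ab ac bc); rewrite ?ta ?tb ?tr// (bot_le _ z0).
by rewrite -(forces_mul t cd) quantale_le_mul2r.
Qed.

(** The parameter [e], a sign, covers two branches that the reflection of the
    second coordinate exchanges. Each ray [c] forced here completes an
    orthogonal triple whose two other rays are orthogonal to rays that are
    already forced; in the end all of (0,1,0), (1,0,1), (1,0,-1) are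
    excluded. *)
Let contradiction t (e : int) : e = 1 \/ e = - 1 -> (t * r)%g = z ->
  forces t (1, 0, 0) -> forces t (1, - e, 0) -> t = z.
Proof.
move=> e1 tr f0 f1.
have f2 : forces t (2, - e, 1).
  apply: (@forcing t (0, 1, e) (1, e, -1)) => //; try by case: e1 => ->.
  - by apply: f0; case: e1 => ->.
  - by apply: f1; case: e1 => ->.
have f3 : forces t (2, - e, -1).
  apply: (@forcing t (0, 1, - e) (1, e, 1)) => //; try by case: e1 => ->.
  - by apply: f0; case: e1 => ->.
  - by apply: f1; case: e1 => ->.
have f4 : forces t (2, 0, -1).
  apply: (@forcing t (0, 1, 0) (1, 0, 2)) => //.
  - exact: f0.
  - by apply: f3; case: e1 => ->.
have f5 : forces t (2, 0, 1).
  apply: (@forcing t (0, 1, 0) (1, 0, -2)) => //.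
  - exact: f0.
  - by apply: f2; case: e1 => ->.
have f6 : forces t (1, - e, -1).
  apply: (@forcing t (1, e, 0) (1, - e, 2)) => //; try by case: e1 => ->.
  - by apply: f1; case: e1 => ->.
  - by apply: f4; case: e1 => ->.
have f7 : forces t (2, - e, 2).
  apply: (@forcing t (2, 2 * e, -1) (1, - 2 * e, -2)) => //;
    try by case: e1 => ->.
  - by apply: f1; case: e1 => ->.
  - by apply: f5; case: e1 => ->.
apply: (le_bot z0).
apply: (@v_basis (0, 1, 0) (1, 0, 1) (1, 0, -1)) => //; last by rewrite tr.
- by rewrite [(_ * _)%g]f0.
- by rewrite [(_ * _)%g]f6//; case: e1 => ->.
- by rewrite [(_ * _)%g]f7//; case: e1 => ->.
Qed.

(** The triple (0,0,1), (1,-1,0), (1,1,0) splits [v (1, 0, 0)] into two branches,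
    since its first ray is orthogonal to (1,0,0). Passing from [t] to
    [t * v c] preserves the exclusions because [v c <= 1]. *)
Lemma kochen_specker : (v (1, 0, 0)%R * r)%g = z -> v (1, 0, 0) = z.
Proof.
set t := v _ => tr.
have ft : forces t (1, 0, 0).
  by rewrite -[t]mul1g; exact: forces_mul.
have branch e : e = 1 \/ e = - 1 -> (t * v (1, - e, 0)%R)%g = z.
  move=> e1; apply: contradiction (e1) _ _ (@forces_mul _ _).
    apply: (le_bot z0); rewrite -tr quantale_le_mul2r//.
    by rewrite -[leRHS]mulg1 quantale_le_mul2l.
  move=> b ab; apply: (le_bot z0); rewrite -(ft b ab).
  by rewrite quantale_le_mul2r// -[leRHS]mulg1 quantale_le_mul2l.
apply: (le_bot z0).
apply: (@v_basis (0, 0, 1) (1, -1, 0) (1, 1, 0)) => //; last by rewrite tr.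
- by rewrite [(_ * _)%g]ft.
- by rewrite [(_ * _)%g]branch//; left.
- by rewrite [(_ * _)%g](branch (-1))//; right.
Qed.
End KochenSpecker.

(** * The commutative C*-algebras of k-tuples of complex numbers *)

(** The algebra C^k. Its norm is that of the diagonal matrix, so that the norm
    axioms and the C*-identity are inherited from the operator norm. *)
Definition cpow (R : realType) (k : nat) : Type := 'rV[complexes R]_k.

Lemma sum_norm_diag_mx (C : numDomainType) k (x : 'rV[C]_k) :
  \sum_i \sum_j `|diag_mx x i j| = \sum_i `|x 0 i|.
Proof.
apply: eq_bigr => i _; rewrite (bigD1 i)//= big1 => [|j ji].
  by rewrite addr0 mxE eqxx.
by rewrite mxE eq_sym (negPf ji) normr0.
Qed.

Section PowerAlgebra.
Variables (R : realType) (k : nat).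
Local Notation C := (complexes R).
Local Notation P := (cpow R k).

Let dnorm (x : 'rV[C]_k) : C := opnorm (diag_mx x).

Let dnormD x y : dnorm (x + y) <= dnorm x + dnorm y.
Proof. by rewrite /dnorm linearD opnormD. Qed.

Let dnormZ (c : C) x : dnorm (c *: x) = `|c| * dnorm x.
Proof. by rewrite /dnorm linearZ opnormZ. Qed.

Let dnorm_eq0 x : dnorm x = 0 -> x = 0.
Proof.
move/opnorm_eq0/matrixP => x0; apply/rowP => i.
by move: (x0 i i); rewrite !mxE eqxx.
Qed.

HB.instance Definition _ := GRing.Lmodule.copy P 'rV[C]_k.
HB.instance Definition _ := Lmodule_isNormed.Build C P dnormD dnormZ dnorm_eq0.

Lemma opnorm_diag_le (x : 'rV[C]_k) (c : C) :
  (forall i, `|x 0 i| <= c) -> opnorm (diag_mx x) <= k%:R * c.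
Proof.
move=> xc; apply: (le_trans (opnorm_le_sum _)).
rewrite sum_norm_diag_mx -[X in X%:R]card_ord mulr_natl -sumr_const.
by apply: ler_sum => i _; exact: xc.
Qed.

(** A Cauchy filter of tuples is Cauchy as a filter of diagonal matrices; the
    diagonal of its limit is the limit sought, since the entries of a matrix
    are bounded by its norm. *)
Lemma cpow_complete (F : set_system P) : ProperFilter F -> cauchy F -> cvg F.
Proof.
move=> FF /cauchy_ballP Fc.
have /cauchy_cvg/cvg_ex[L FL] :
    cauchy ((fun x : P => diag_mx x : cmatrix R k) @ F).
  apply/cauchy_ballP => e e0; rewrite near_map2; have := Fc _ e0.
  apply: filterS => -[x y]; rewrite -!ball_normE/= => xy.
  by move: xy; rewrite [X in X < _]/Num.norm/= /dnorm linearB.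
pose l : P := \row_i L i i.
apply/cvg_ex; exists l; apply/cvgrPdist_lt => e e0.
have e1 : 0 < e / k.+1%:R by rewrite divr_gt0.
move/cvgrPdist_lt : FL => /(_ _ e1); apply: filterS => x.
set d := `|_| => xL.
have : `|l - x| <= k%:R * d.
  apply: opnorm_diag_le => i.
  by have := opnorm_coord (L - diag_mx x : 'M[C]_k) i i; rewrite !mxE eqxx.
move/le_lt_trans; apply.
have kS : k%:R <= k.+1%:R :> C by rewrite ler_nat.
apply: (le_lt_trans (ler_wpM2r (normr_ge0 _) kS)).
by rewrite mulrC -ltr_pdivlMr.
Qed.

HB.instance Definition _ := Uniform_isComplete.Build P cpow_complete.

Definition rowM (x y : P) : P := \row_i (x 0 i * y 0 i).

Let diagM (x y : P) : diag_mx (rowM x y) = diag_mx x *m diag_mx y.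
Proof. by rewrite mulmx_diag. Qed.

Let rowMA : associative rowM.
Proof. by move=> x y z; apply/rowP => i; rewrite !mxE mulrA. Qed.

Let row1M : left_id (const_mx 1) rowM.
Proof. by move=> x; apply/rowP => i; rewrite !mxE mul1r. Qed.

Let rowM1 : right_id (const_mx 1) rowM.
Proof. by move=> x; apply/rowP => i; rewrite !mxE mulr1. Qed.

HB.instance Definition _ := isMonoid.Build P rowMA row1M rowM1.

Let rowMDl (x y z : P) : rowM (x + y) z = rowM x z + rowM y z.
Proof. by apply/rowP => i; rewrite !mxE mulrDl. Qed.

Let rowMDr (x y z : P) : rowM x (y + z) = rowM x y + rowM x z.
Proof. by apply/rowP => i; rewrite !mxE mulrDr. Qed.

Let rowZM (c : C) (x y : P) : rowM (c *: x) y = c *: rowM x y.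
Proof. by apply/rowP => i; rewrite !mxE mulrA. Qed.

Let rowMZ (c : C) (x y : P) : rowM x (c *: y) = c *: rowM x y.
Proof. by apply/rowP => i; rewrite !mxE mulrCA. Qed.

Let dnormM (x y : P) : dnorm (rowM x y) <= dnorm x * dnorm y.
Proof. by rewrite /dnorm diagM opnormM. Qed.

Definition rowJ (x : P) : P := map_mx Num.conj x.

Let rowJK : involutive rowJ.
Proof. by move=> x; apply/rowP => i; rewrite !mxE conjCK. Qed.

Let rowJD : {morph rowJ : x y / x + y}.
Proof. by move=> x y; apply/rowP => i; rewrite !mxE rmorphD. Qed.

Let rowJZ (c : C) x : rowJ (c *: x) = c^* *: rowJ x.
Proof. by apply/rowP => i; rewrite !mxE rmorphM. Qed.

Let rowJM x y : rowJ (rowM x y) = rowM (rowJ y) (rowJ x).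
Proof. by apply/rowP => i; rewrite !mxE rmorphM mulrC. Qed.

Let dnormJM (x : P) : dnorm (rowM (rowJ x) x) = dnorm x ^+ 2.
Proof.
rewrite /dnorm diagM.
have -> : diag_mx (rowJ x) = diag_mx x ^t* by rewrite tr_diag_mx map_diag_mx.
exact: opnorm_adjM.
Qed.

HB.instance Definition _ := isCstar.Build R P
  rowMDl rowMDr rowZM rowMZ dnormM rowJK rowJD rowJZ rowJM dnormJM.

Lemma cpow_commutative : @commutative_alg R P.
Proof. by move=> x y; apply/rowP => i; rewrite !mxE mulrC. Qed.
End PowerAlgebra.

(** * Resolutions of the identity *)

Section StarHomFacts.
Variables (R : realType) (A B : cstarType R) (f : star_hom A B).

Lemma star_homD a b : f (a + b) = f a + f b.
Proof. by have := star_hom_linear f 1 a b; rewrite !scale1r. Qed.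

Lemma star_hom0 : f 0 = 0.
Proof. by apply: (addrI (f 0)); rewrite -star_homD !addr0. Qed.

Lemma star_homZ c a : f (c *: a) = c *: f a.
Proof. by have := star_hom_linear f c a 0; rewrite star_hom0 !addr0. Qed.

Lemma star_homB a b : f (a - b) = f a - f b.
Proof. by rewrite star_homD -scaleN1r star_homZ scaleN1r. Qed.

Lemma star_hom_sum (I : finType) (F : I -> A) :
  f (\sum_i F i) = \sum_i f (F i).
Proof. exact: (big_morph _ star_homD star_hom0). Qed.
End StarHomFacts.

Section CstarFacts.
Variables (R : realType) (B : cstarType R).
Implicit Types a b : B.

Lemma mul0g a : (0%R * a)%g = 0 :> B.
Proof. by have := scalegAl 0 (0 : B) a; rewrite !scale0r. Qed.

Lemma mulg0 a : (a * 0%R)%g = 0 :> B.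
Proof. by have := scalegAr 0 a (0 : B); rewrite !scale0r. Qed.

Lemma star0 : star 0 = 0 :> B.
Proof. by have := starZ 0 (0 : B); rewrite conjC0 !scale0r. Qed.

Lemma star1 : star 1%g = 1%g :> B.
Proof. by have := starM (star (1%g : B)) 1%g; rewrite mulg1 starK mulg1. Qed.

Lemma mulgNl a b : ((- a)%R * b)%g = - (a * b)%g :> B.
Proof. by apply/eqP; rewrite -addr_eq0 -mulgDl addNr mul0g. Qed.

Lemma mulgNr a b : (a * (- b)%R)%g = - (a * b)%g :> B.
Proof. by apply/eqP; rewrite -addr_eq0 -mulgDr addNr mulg0. Qed.

Lemma starN a : star (- a) = - star a.
Proof. by apply/eqP; rewrite -addr_eq0 -starD addNr star0. Qed.

Lemma mulg_sumr (I : finType) a (F : I -> B) :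
  (a * (\sum_i F i)%R)%g = \sum_i (a * F i)%g.
Proof. by apply: (big_morph _ (mulgDr a) (mulg0 a)). Qed.

Lemma mulg_suml (I : finType) a (F : I -> B) :
  ((\sum_i F i)%R * a)%g = \sum_i (F i * a)%g.
Proof. exact: (big_morph _ (fun b c => mulgDl b c a) (mul0g a)). Qed.

Lemma star_sum (I : finType) (F : I -> B) :
  star (\sum_i F i) = \sum_i star (F i).
Proof. exact: (big_morph _ starD star0). Qed.

Definition orthogonal_projections k (q : 'I_k -> B) :=
  (forall i, star (q i) = q i) /\
  (forall i j, (q i * q j)%g = q i *+ (i == j)).

Definition resolution k (p : 'I_k -> B) :=
  orthogonal_projections p /\ \sum_i p i = 1%g.

Lemma orthogonal_projections1 k (q : 'I_k -> B) i :
  orthogonal_projections q -> orthogonal_projections (fun _ : 'I_1 => q i).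
Proof. by move=> [qJ qM]; split=> // j l; rewrite qM eqxx !ord1. Qed.

(** The remainder comes at index [ord0], the given projections come after. *)
Definition complete_family k (q : 'I_k -> B) (i : 'I_k.+1) : B :=
  if unlift ord0 i is Some j then q j else 1%g - \sum_j q j.

Lemma complete_family0 k (q : 'I_k -> B) :
  complete_family q ord0 = 1%g - \sum_j q j.
Proof. by rewrite /complete_family unlift_none. Qed.

Lemma complete_family_lift k (q : 'I_k -> B) j :
  complete_family q (lift ord0 j) = q j.
Proof. by rewrite /complete_family liftK. Qed.

Lemma complete_family_resolution k (q : 'I_k -> B) :
  orthogonal_projections q -> resolution (complete_family q).
Proof.
move=> [qJ qM]; set s := \sum_j q j.
have qs j : (q j * s)%g = q j.
  rewrite mulg_sumr (bigD1 j)//= big1 => [|l lj]; first by rewrite qM eqxx addr0.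
  by rewrite qM eq_sym (negPf lj).
have sq j : (s * q j)%g = q j.
  rewrite mulg_suml (bigD1 j)//= big1 => [|l lj]; first by rewrite qM eqxx addr0.
  by rewrite qM (negPf lj).
have ss : (s * s)%g = s.
  by rewrite {1}/s mulg_suml; apply: eq_bigr => j _; exact: qs.
split; last first.
  rewrite big_ord_recl complete_family0.
  have -> : \sum_j complete_family q (lift ord0 j) = s.
    by apply: eq_bigr => j _; exact: complete_family_lift.
  by rewrite subrK.
split=> [i|i j].
  case: (unliftP ord0 i) => [l|] ->; first by rewrite complete_family_lift.
  by rewrite complete_family0 starD starN star1 star_sum (eq_bigr q).
case: (unliftP ord0 i) => [l|] ->; case: (unliftP ord0 j) => [m|] ->;
  rewrite ?complete_family_lift ?complete_family0 -/s.
- by rewrite qM (inj_eq lift_inj).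
- by rewrite mulgDr mulgNr mulg1 qs subrr.
- by rewrite mulgDl mulgNl mul1g sq subrr.
- by rewrite mulgDr mulgNr !mulgDl !mulgNl !mul1g mulg1 ss subrr subr0.
Qed.

(** A resolution into k projections amounts to a *-homomorphism from C^k. *)
Section ResolutionHom.
Variables (k : nat) (p : 'I_k -> B) (pR : resolution p).

Let f (x : cpow R k) : B := \sum_i x 0 i *: p i.

Let f_linear : linear f.
Proof.
move=> c x y; rewrite /f scaler_sumr -big_split; apply: eq_bigr => i _.
by rewrite !mxE scalerDl scalerA.
Qed.

Let f1 : f 1%g = 1%g.
Proof.
have [_ p1] := pR; rewrite /f -p1; apply: eq_bigr => i _.
by rewrite mxE scale1r.
Qed.

Let fM x y : f (x * y)%g = (f x * f y)%g.
Proof.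
have [[_ pM] _] := pR; rewrite /f mulg_suml; apply: eq_bigr => i _.
rewrite mulg_sumr (bigD1 i)//= big1 => [|j ji].
  by rewrite addr0 scalegAl scalegAr pM eqxx scalerA mxE.
by rewrite scalegAl scalegAr pM eq_sym (negPf ji) !scaler0.
Qed.

Let fJ x : f (star x) = star (f x).
Proof.
have [[pJ _] _] := pR; rewrite /f star_sum; apply: eq_bigr => i _.
by rewrite starZ pJ mxE.
Qed.

Definition resolution_hom : star_hom (cpow R k) B := StarHom f_linear f1 fM fJ.

Lemma resolution_homE x : resolution_hom x = \sum_i x 0 i *: p i.
Proof. by []. Qed.
End ResolutionHom.
End CstarFacts.

(** The minimal projections of C^k: the universal resolution. *)
Section Units.
Variables (R : realType) (k : nat).
Local Notation P := (cpow R k).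

Definition cunit (i : 'I_k) : P := delta_mx 0 i.

Lemma cunit_resolution : resolution cunit.
Proof.
split; first split=> [i|i j].
- by apply/rowP => l; rewrite !mxE eqxx; case: (l == i); rewrite ?conjC1 ?conjC0.
- apply/rowP => l.
  have [<-|ij] := eqVneq i j; rewrite !mxE !eqxx.
    by case: (l == i); rewrite ?mulr1 ?mulr0.
  have [->|_] := eqVneq l i; last by rewrite mul0r.
  by rewrite (negPf ij) mulr0.
- rewrite [RHS](row_sum_delta (const_mx 1 : 'rV[complexes R]_k)).
  by apply: eq_bigr => i _; rewrite mxE scale1r.
Qed.

Lemma resolution_hom_unit (B : cstarType R) (p : 'I_k -> B)
    (pR : resolution p) i :
  resolution_hom pR (cunit i) = p i.
Proof.
rewrite resolution_homE (bigD1 i)//= big1 => [|j ji].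
  by rewrite addr0 mxE !eqxx scale1r.
by rewrite mxE eqxx (negPf ji) scale0r.
Qed.
End Units.

(** * The coloring of projections by elements of a quantale *)

(** The two conditions on a Kochen-Specker coloring, with values in a quantale:
    exactly one member of each resolution is true. *)
Definition coloring (R : realType) (B : cstarType R) (Q : quantaleType)
    (v : B -> Q) :=
  forall k (p : 'I_k -> B), resolution p ->
    isLub (range (fun i => v (p i))) 1%g /\
    forall z, isLub set0 z -> forall i j, i != j -> (v (p i) * v (p j))%g = z.

Section ColoringFacts.
Variables (R : realType) (B : cstarType R) (Q : quantaleType) (z : Q).
Variable v : B -> Q.
Hypothesis z0 : isLub set0 z.
Hypothesis vC : coloring v.

Lemma coloring_le1 k (q : 'I_k -> B) i :
  orthogonal_projections q -> (v (q i) <= 1%g)%O.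
Proof.
move=> qP; have [[ub _] _] := vC (complete_family_resolution qP).
by apply: ub; exists (lift ord0 i) => //; rewrite complete_family_lift.
Qed.

Lemma coloring_orth k (q : 'I_k -> B) i j :
  orthogonal_projections q -> i != j -> (v (q i) * v (q j))%g = z.
Proof.
move=> qP ij; rewrite -(complete_family_lift q i) -(complete_family_lift q j).
by rewrite ((vC (complete_family_resolution qP)).2 z z0)// (inj_eq lift_inj).
Qed.

Lemma coloring_rest k (q : 'I_k -> B) i :
  orthogonal_projections q -> (v (q i) * v (1%g - \sum_j q j)%R)%g = z.
Proof.
move=> qP; rewrite -(complete_family_lift q i) -complete_family0.
exact: ((vC (complete_family_resolution qP)).2 z z0).
Qed.

Lemma coloring_split k (q : 'I_k -> B) t x :
  orthogonal_projections q ->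
  (forall i, (t * v (q i))%g <= x)%O ->
  ((t * v (1%g - \sum_j q j)%R)%g <= x)%O -> (t <= x)%O.
Proof.
move=> qP tq tr; apply: (unit_lub_le (vC (complete_family_resolution qP)).1) => i.
by case: (unliftP ord0 i) => [j|] ->;
  rewrite ?complete_family_lift ?complete_family0.
Qed.
End ColoringFacts.

Section Cozero.
Variable R : realType.

Lemma cozero_open (A : cstarType R) (a : A) :
  open [set chi : spectrum A | character_fun chi a != 0].
Proof.
apply: (@open_comp _ _ (fun chi : spectrum A => character_fun chi a)
  [set c | c != 0]) => [chi _|]; first exact: character_eval_continuous.
rewrite (_ : mkset _ = ~` [set 0]); last first.
  by apply/seteqP; split=> c /=; [move=> /eqP|move=> c0; apply/eqP].
apply: closed_openC; apply: accessible_closed_set1.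
exact: hausdorff_accessible (@norm_hausdorff _ (complexes R)^o).
Qed.

(** The open part of the spectrum cut out by [a]. For a projection of C^k it is
    a clopen set, but its points need not be known. *)
Definition cozero (A : cstarType R) (a : A) : opens (spectrum A) :=
  mk_opens (cozero_open a).

Lemma spectrum_pullback_cozero (A B : cstarType R) (f : star_hom A B) a :
  spectrum_pullback f (cozero a) = cozero (f a).
Proof. exact/val_inj. Qed.

Lemma cozero_mul0 (A : cstarType R) (a b : A) : (a * b)%g = 0 ->
  (cozero a * cozero b)%g = opens_union set0.
Proof.
move=> ab; apply/val_inj; rewrite /= bigcup_set0 -subset0 => chi [/= ca cb].
have /eqP := star_homM chi a b; rewrite ab star_hom0 eq_sym.
by rewrite mulf_eq0 (negPf ca) (negPf cb).
Qed.

(** A character sends 1 to 1, so it cannot vanish on all the [p i]. *)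
Lemma cozero_cover (A : cstarType R) k (p : 'I_k -> A) : \sum_i p i = 1%g ->
  isLub (range (fun i => cozero (p i))) 1%g.
Proof.
move=> p1.
suff -> : 1%g = opens_union (range (fun i => cozero (p i))).
  exact: opens_unionP.
apply/val_inj; rewrite /= bigcup_image; apply/esym/seteqP; split=> // chi _.
have [i ci] : exists i, chi (p i) != 0.
  apply: contrapT => /forallNP c0.
  have := star_hom1 chi; rewrite -p1 star_hom_sum big1 => [/eqP|i _].
    by rewrite eq_sym oner_eq0.
  by apply/eqP/negPn/negP; exact: c0.
by exists i.
Qed.
End Cozero.

Section Coloring.
Variable R : realType.
Variable G : functor (opposite (Cstar_cat R)) (opposite Quantale_cat).
Hypothesis G_Gelfand :
  naturally_isomorphic (restrict_op (@commutative_alg R) G) (Gelfand R).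

Definition qmap (A B : cstarType R) (f : star_hom A B) :
  quantale_hom (G A) (G B) := @Defs.fmap _ _ G B A f.

Lemma qmap_comp (A B D : cstarType R) (f : star_hom A B) (g : star_hom B D) x :
  qmap g (qmap f x) = qmap (star_hom_comp f g) x.
Proof.
have := @Defs.fmap_comp _ _ G D B A g f.
by move=> /(congr1 (fun h : quantale_hom _ _ => h x)).
Qed.

(** The components of the natural isomorphism, as quantale morphisms from the
    opens of the spectra. *)
Lemma open_set_transformation : exists w : forall A : cstarType R,
    commutative_alg A -> quantale_hom (opens (spectrum A)) (G A),
  forall (A B : cstarType R) (cA : commutative_alg A) (cB : commutative_alg B)
    (f : star_hom A B) U, qmap f (w A cA U) = w B cB (spectrum_pullback f U).
Proof.
have [eta [_ nat_eta]] := G_Gelfand.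
exists (fun A cA => eta (exist _ A cA)) => A B cA cB f U.
have := nat_eta (exist _ B cB) (exist _ A cA) f.
by move=> /(congr1 (fun h : quantale_hom _ _ => h U)).
Qed.

(** [v p] is the image of the first point of C^2 under the *-homomorphism that
    sends the two points to [p] and to its complement. When [p] is a member
    [p i] of a resolution, that *-homomorphism factors through the one from C^k
    given by the resolution, so [v (p i)] is also the image of the [i]-th point
    of C^k. *)
Lemma projection_coloring (B : cstarType R) :
  exists v : B -> (G B : quantaleType), coloring v.
Proof.
have [w nat_w] := open_set_transformation.
pose wc k := w (cpow R k) (@cpow_commutative R k).
pose v p : (G B : quantaleType) :=
  if pselect (orthogonal_projections (fun _ : 'I_1 => p)) is left pP then
    qmap (resolution_hom (complete_family_resolution pP))
      (wc 2%N (cozero (cunit R (lift ord0 ord0))))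
  else 1%g.
have vE k (p : 'I_k -> B) (pR : resolution p) i :
    v (p i) = qmap (resolution_hom pR) (wc k (cozero (cunit R i))).
  (* Both sides come from C^2: u sends its points to the i-th unit of C^k and
     to the complement of that unit. *)
  rewrite /v; case: pselect => [pP|]; last first.
    by case; exact: orthogonal_projections1 pR.1.
  have uP := orthogonal_projections1 i (cunit_resolution R k).1.
  pose u := resolution_hom (complete_family_resolution uP).
  have -> : cozero (cunit R i) =
      spectrum_pullback u (cozero (cunit R (lift ord0 ord0))).
    by rewrite spectrum_pullback_cozero resolution_hom_unit complete_family_lift.
  rewrite /wc -(nat_w _ _ (@cpow_commutative R 2)) qmap_comp.
  congr (qmap _ _).
  apply: star_hom_ext => x.
  rewrite -[RHS]/(resolution_hom pR (u x)) [u x]resolution_homE star_hom_sum.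
  rewrite [LHS]resolution_homE.
  apply: eq_bigr => j _; rewrite star_homZ; congr (_ *: _).
  case: (unliftP ord0 j) => [l|] ->;
    rewrite ?complete_family_lift ?complete_family0.
    by rewrite resolution_hom_unit.
  by rewrite star_homB star_hom1 star_hom_sum !big_ord1 resolution_hom_unit.
exists v => k p pR.
pose h := quantale_hom_comp (wc k) (qmap (resolution_hom pR)).
have vh i : v (p i) = h (cozero (cunit R i)) by exact: vE.
split=> [|z z0 i j ij].
  have := quantale_hom_lub h (cozero_cover (cunit_resolution R k).2).
  by rewrite quantale_hom1 image_comp (funext vh).
have ij0 : (cunit R i * cunit R j)%g = 0.
  by have [[_ uM] _] := cunit_resolution R k; rewrite uM (negPf ij).
rewrite !vh -(quantale_homM h) (cozero_mul0 ij0).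
have := quantale_hom_lub h (opens_unionP set0); rewrite image_set0 => hz.
exact: isLub_unique hz z0.
Qed.
End Coloring.

(** * Rank-one projections of matrices *)

Section Rays.
Variable C : numClosedFieldType.

Definition dot n (u w : 'cV[C]_n) : C := (u ^t* *m w) 0 0.

Lemma dot_sum n (u w : 'cV[C]_n) : dot u w = \sum_i (u i 0)^* * w i 0.
Proof. by rewrite /dot mxE; apply: eq_bigr => i _; rewrite !mxE. Qed.

Lemma dotE n (u w : 'cV[C]_n) : u ^t* *m w = (dot u w)%:M.
Proof. by rewrite [LHS]mx11_scalar. Qed.

Lemma adj_mul m n p (A : 'M[C]_(m, n)) (B : 'M[C]_(n, p)) :
  (A *m B) ^t* = B ^t* *m A ^t*.
Proof. by rewrite trmx_mul map_mxM. Qed.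

Lemma adjK m n (A : 'M[C]_(m, n)) : A ^t* ^t* = A.
Proof. by apply/matrixP => i j; rewrite !mxE conjCK. Qed.

Lemma adjZ m n c (A : 'M[C]_(m, n)) : (c *: A) ^t* = c^* *: A ^t*.
Proof. by apply/matrixP => i j; rewrite !mxE rmorphM. Qed.

Lemma conj_dot n (u w : 'cV[C]_n) : (dot u w)^* = dot w u.
Proof. by rewrite /dot -[in RHS](adjK u) -adj_mul !mxE. Qed.

(** The projection on the line spanned by [u]; when [u] is zero, so is it,
    thanks to [0^-1 = 0]. *)
Definition ray n (u : 'cV[C]_n) : 'M[C]_n := (dot u u)^-1 *: (u *m u ^t*).

Lemma ray_adj n (u : 'cV[C]_n) : (ray u) ^t* = ray u.
Proof. by rewrite /ray adjZ adj_mul adjK fmorphV/= conj_dot. Qed.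

Lemma ray_mul n (u w : 'cV[C]_n) :
  ray u *m ray w = ((dot u u)^-1 * (dot w w)^-1 * dot u w) *: (u *m w ^t*).
Proof.
rewrite /ray -scalemxAl -scalemxAr scalerA mulmxA -(mulmxA u) dotE.
by rewrite mul_mx_scalar -scalemxAl scalerA.
Qed.

Lemma ray_orth n (u w : 'cV[C]_n) : dot u w = 0 -> ray u *m ray w = 0.
Proof. by move=> uw; rewrite ray_mul uw mulr0 scale0r. Qed.

Lemma ray_idem n (u : 'cV[C]_n) : ray u *m ray u = ray u.
Proof.
rewrite ray_mul /ray; congr (_ *: _).
have [->|u0] := eqVneq (dot u u) 0; first by rewrite mulr0 invr0.
by rewrite mulfVK.
Qed.

(** The matrix with columns [u i] has a left inverse, with rows the scaled
    conjugates; that it is also a right inverse is the claim. *)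
Lemma ray_sum n (u : 'I_n -> 'cV[C]_n) :
  (forall i, dot (u i) (u i) != 0) ->
  (forall i j, i != j -> dot (u i) (u j) = 0) -> \sum_i ray (u i) = 1%:M.
Proof.
move=> u0 u_orth.
pose U : 'M[C]_n := \matrix_(i, j) u j i 0.
pose V : 'M[C]_n := \matrix_(j, i) ((dot (u j) (u j))^-1 * (u j i 0)^*).
have VU : V *m U = 1%:M.
  apply/matrixP => j l.
  have -> : (V *m U) j l = (dot (u j) (u j))^-1 * dot (u j) (u l).
    rewrite (dot_sum (u j) (u l)) mulr_sumr mxE; apply: eq_bigr => i _.
    by rewrite !mxE mulrA.
  rewrite mxE; have [<-|jl] := eqVneq j l; first by rewrite mulVf.
  by rewrite (u_orth _ _ jl) mulr0.
rewrite -(mulmx1C VU); apply/matrixP => i l; rewrite summxE !mxE.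
apply: eq_bigr => j _; by rewrite !mxE big_ord1 !mxE mulrCA.
Qed.

Definition isometric_mx m n (S : 'M[C]_(m, n)) := S ^t* *m S = 1%:M.

Lemma isometric_dot m n (S : 'M[C]_(m, n)) u w :
  isometric_mx S -> dot (S *m u) (S *m w) = dot u w.
Proof.
by move=> SS; rewrite /dot adj_mul mulmxA -(mulmxA (u ^t*)) SS mulmx1.
Qed.

Lemma isometric_ray m n (S : 'M[C]_(m, n)) u :
  isometric_mx S -> ray (S *m u) = S *m ray u *m S ^t*.
Proof.
move=> SS; rewrite /ray isometric_dot// adj_mul -scalemxAr -scalemxAl.
by rewrite !mulmxA.
Qed.

Definition icol (a : ivec) : 'cV[C]_3 :=
  \col_i (nth 0 [:: a.1.1; a.1.2; a.2] i)%:~R.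

Lemma dot_icol a b : dot (icol a) (icol b) = (idot a b)%:~R.
Proof.
rewrite dot_sum !big_ord_recl big_ord0 addr0 addrA !mxE /= !rmorph_int.
by rewrite /idot !intrD !intrM.
Qed.

Definition select_mx m n (s : 'I_n -> 'I_m) : 'M[C]_(m, n) :=
  \matrix_(i, j) (i == s j)%:R.

Lemma select_mx_isometric m n (s : 'I_n -> 'I_m) :
  injective s -> isometric_mx (select_mx s).
Proof.
move=> s_inj; apply/matrixP => j l; rewrite !mxE (bigD1 (s j))//= big1 => [|i ij].
  by rewrite !mxE eqxx conjC1 mul1r addr0 (inj_eq s_inj).
by rewrite !mxE (negPf ij) conjC0 mul0r.
Qed.

Lemma select_mx_icol m (s : 'I_3 -> 'I_m) :
  select_mx s *m icol (1, 0, 0) = delta_mx (s 0) 0.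
Proof.
apply/colP => i; rewrite !mxE !big_ord_recl big_ord0 !mxE/=.
by rewrite mulr1 !mulr0 !addr0 andbT.
Qed.

Lemma dot_delta n (i j : 'I_n) : dot (delta_mx i 0) (delta_mx j 0) = (i == j)%:R.
Proof.
rewrite dot_sum (bigD1 i)//= big1 => [|l li].
  by rewrite !mxE !eqxx conjC1 mul1r addr0 andbT.
by rewrite !mxE (negPf li) conjC0 mul0r.
Qed.
End Rays.

(** * Matrix algebras *)

Section MatrixColoring.
Variables (R : realType) (n : nat) (Q : quantaleType) (z : Q).
Local Notation C := (complexes R).
Variable v : cmatrix R n -> Q.
Hypothesis z0 : isLub set0 z.
Hypothesis vC : coloring v.

Lemma ray_projections k (u : 'I_k -> 'cV[C]_n) :
  (forall i j, i != j -> dot (u i) (u j) = 0) ->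
  orthogonal_projections (fun i => ray (u i) : cmatrix R n).
Proof.
move=> u_orth; split=> [i|i j]; first exact: ray_adj.
have [<-|ij] := eqVneq i j; first exact: ray_idem.
exact: ray_orth (u_orth _ _ ij).
Qed.

Section Isometry.
Variable S : 'M[C]_(n, 3).
Hypothesis SS : isometric_mx S.

Let u (a : ivec) : 'cV[C]_n := S *m icol C a.
Let r := v (1%:M - S *m S ^t*).

Let dot_u a b : dot (u a) (u b) = (idot a b)%:~R.
Proof. by rewrite isometric_dot// dot_icol. Qed.

Let u_projections k (s : 'I_k -> ivec) :
  (forall i j, i != j -> idot (s i) (s j) = 0) ->
  orthogonal_projections (fun i => ray (u (s i)) : cmatrix R n).
Proof. by move=> so; apply: ray_projections => i j ij; rewrite dot_u so. Qed.

Let triple (a b c : ivec) (i : 'I_3) := nth a [:: a; b; c] i.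

Let tripleP (P : ivec -> Prop) a b c i : P a -> P b -> P c ->
  P (triple a b c i).
Proof. by case: i => [[|[|[|//]]] ?]. Qed.

Let idotC a b : idot a b = idot b a.
Proof. by rewrite /idot; congr (_ + _ + _); rewrite mulrC. Qed.

Let triple_orth a b c : idot a b = 0 -> idot a c = 0 -> idot b c = 0 ->
  forall i j, i != j -> idot (triple a b c i) (triple a b c j) = 0.
Proof.
move=> ab ac bc.
by case=> [[|[|[|//]]] ?] [[|[|[|//]]] ?] //= _; rewrite // idotC.
Qed.

Let triple_sum a b c : idot a a != 0 -> idot b b != 0 -> idot c c != 0 ->
  idot a b = 0 -> idot a c = 0 -> idot b c = 0 ->
  \sum_i ray (u (triple a b c i)) = S *m S ^t*.
Proof.
move=> a0 b0 c0 ab ac bc.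
under eq_bigr do rewrite isometric_ray//.
rewrite -mulmx_suml -mulmx_sumr ray_sum ?mulmx1// => [i|i j ij].
  by rewrite dot_icol intr_eq0; apply: (tripleP (P := fun d => idot d d != 0)).
by rewrite dot_icol triple_orth.
Qed.

(** The projections on the lines through the [u a] of an orthogonal triple add
    up to that on the range of [S], whatever the triple; so the remainder [r]
    is common to all these resolutions, as [kochen_specker] requires. *)
Lemma isometric_ray_bot : v (ray (u (1, 0, 0))) = z.
Proof.
apply: (@kochen_specker Q z (fun a => v (ray (u a))) r z0).
- move=> a; apply: (coloring_le1 (q := fun _ : 'I_1 => ray (u a)) vC ord0).
  by apply: (u_projections (s := fun=> a)) => i j; rewrite !ord1.
- move=> a b ab.
  pose s (i : 'I_2) := if i == 0 then a else b.
  have sP : orthogonal_projections (fun i => ray (u (s i)) : cmatrix R n).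
    apply: u_projections.
    by case=> [[|[|//]] ?] [[|[|//]] ?] //= _; rewrite // idotC.
  exact: (coloring_orth z0 vC (i := 0) (j := 1) sP).
- move=> a b c a0 b0 c0 ab ac bc t x ta tb tc tr.
  apply: (coloring_split vC (u_projections (triple_orth ab ac bc))).
    by move=> i; apply: (tripleP (P := fun d => (t * v (ray (u d)))%g <= x)%O).
  by rewrite triple_sum.
- have eP := u_projections (@triple_orth (1, 0, 0) (0, 1, 0) (0, 0, 1)
    erefl erefl erefl).
  by have := coloring_rest z0 vC ord0 eP; rewrite triple_sum.
Qed.
End Isometry.
End MatrixColoring.

(** The coordinate axes are all colored by the bottom, and they resolve the
    identity. *)
Lemma matrix_coloring_trivial (R : realType) n (Q : quantaleType) (z : Q)
    (v : cmatrix R n -> Q) :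
  (3 <= n)%N -> isLub set0 z -> coloring v -> z = 1%g.
Proof.
case: n v => [|[|[|m]]] // v _ z0 vC.
have v_ray i : v (ray (delta_mx i 0)) = z.
  (* Three distinct axes, the first one the i-th: indices count modulo n. *)
  pose s (j : 'I_3) : 'I_m.+3 := i + inord j.
  have s_inj : injective s.
    move=> j l /addrI/(congr1 (@nat_of_ord _)).
    rewrite !inordK ?(leq_trans (ltn_ord _))//.
    exact: val_inj.
  have := isometric_ray_bot z0 vC (select_mx_isometric _ s_inj).
  rewrite select_mx_icol /s (_ : inord _ = 0) ?addr0//.
  by apply/val_inj; rewrite /= inordK.
apply/esym/(le_bot z0).
have eR : resolution (fun i => ray (delta_mx i 0) : cmatrix R m.+3).
  have e_orth (i j : 'I_m.+3) :
      i != j -> dot (delta_mx i 0) (delta_mx j 0) = 0 :> complexes R.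
    by move=> ij; rewrite dot_delta (negPf ij).
  split; first exact: ray_projections e_orth.
  by apply: ray_sum e_orth => i; rewrite dot_delta eqxx oner_eq0.
by apply: (unit_lub_le (vC _ _ eR).1) => i; rewrite mul1g v_ray.
Qed.

Lemma point_initial (Q : quantaleType) (x : Q) : (forall y, y = x) ->
  @is_initial (opposite Quantale_cat) Q.
Proof.
move=> Qx P.
have hom1 : x = 1%g by rewrite [RHS]Qx.
have homM (a b : P) : x = (x * x)%g by rewrite [RHS]Qx.
have homL (A : set P) s : isLub A s -> isLub ((fun=> x) @` A) x.
  by move=> _; split=> y _; rewrite [y]Qx.
exists (@QuantaleHom P Q (fun=> x) hom1 homM homL) => g.
by apply: quantale_hom_ext => a; rewrite [LHS]Qx.
Qed.

Theorem corollary5p7 (R : realType) (n : nat) (n_ge3 : (3 <= n)%N)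
  (G : functor (opposite (Cstar_cat R)) (opposite Quantale_cat))
  (G_Gelfand :
     naturally_isomorphic (restrict_op (@commutative_alg R) G) (Gelfand R)) :
  is_initial (G (cmatrix R n)) /\
  (exists x : (G (cmatrix R n) : quantaleType),
     forall y : (G (cmatrix R n) : quantaleType), y = x).
Proof.
have [v vC] := projection_coloring G_Gelfand (cmatrix R n).
have [z z0] := has_lub (set0 : set (G (cmatrix R n) : quantaleType)).
have z1 := matrix_coloring_trivial n_ge3 z0 vC.
have triv := quantale_trivial z0 z1.
by split; [exact: point_initial triv|exists z].
Qed.
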